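(* Let $(\mathcal{A},\phi)$ be a non-commutative probability space, let $\mathcal{A}^\circ=\mathcal{A}\setminus\ker\phi$, and let $\{\mathcal{A}_i\}_{i\in I}$ be a family of unital subalgebras of $\mathcal{A}$. The following statements are equivalent: (i) $\{\mathcal{A}_i\}_{i\in I}$ are free. (ii) For all positive integers $n$, all $i(1),\dots,i(n)\in I$ and all $a_k\in\mathcal{A}_{i(k)}$ ($k=1,\dots,n$) with $a_2,\dots,a_n\in\mathcal{A}^\circ$, we have $t_{n-1}(a_1,\dots,a_n)=0$ whenever there exist $1\le l,k\le n$ with $i(l)\ne i(k)$.
   Context: A non-commutative probability space is a couple $(\mathcal{A},\phi)$, where $\mathcal{A}$ is a unital ($*$-)algebra over $\mathbb{C}$ and $\phi:\mathcal{A}\to\mathbb{C}$ is a linear map with $\phi(1)=1$ (and $\phi(x^*x)\ge 0$ for all $x\in\mathcal{A}$ if $\mathcal{A}$ is a $*$-algebra). A family $\{\mathcal{A}_i\}_{i\in I}$ of unital subalgebras of $\mathcal{A}$ is free if $\phi(a_1a_2\cdots a_n)=0$ whenever $n\ge 1$, $a_k\in\mathcal{A}_{\varepsilon(k)}$, $\varepsilon(j)\ne\varepsilon(j+1)$ for $1\le j\le n-1$, and $\phi(a_k)=0$ for all $k$. A non-crossing linked partition $\pi$ of $\{1,\dots,n\}$ is a collection $B_1,\dots,B_k$ of distinct nonempty subsets (blocks) of $\{1,\dots,n\}$ such that: (a) $\bigcup_{l=1}^k B_l=\{1,\dots,n\}$; (b) there are no two distinct blocks $B_l,B_s$ and $i<m<p<q$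 with $i,p\in B_l$ and $m,q\in B_s$; (c) for any two distinct blocks $B_l,B_s$, the intersection $B_l\cap B_s$ is either empty or contains only one element, and if $\{j\}=B_l\cap B_s$ then $|B_l|,|B_s|\ge 2$ and $j$ is the minimal element of exactly one of the blocks $B_l$ and $B_s$. The set of all of these is $NCL(n)$. For $\pi\in NCL(n)$, $s(\pi)$ denotes the set of all $k\in\{1,\dots,n\}$ such that no block of $\pi$ has minimal element $k$. The $t$-coefficients are the maps $t_n:\mathcal{A}\times(\mathcal{A}^\circ)^n\to\mathbb{C}$, $n\ge 0$, determined by the recurrence $$\phi(X_1\cdots X_n)=\sum_{\pi\in NCL(n)}\Big(\prod_{\substack{B\text{ block of }\pi\\ B=(i_1<\dots<i_l)}}t_{l-1}(X_{i_1},\dots,X_{i_l})\cdot\prod_{k\in s(\pi)}t_0(X_k)\Big)$$ for all $n\ge1$, $X_1\in\mathcal{A}$, $X_2,\dots,X_n\in\mathcal{A}^\circ$. In particular $t_0=\phi$. The recurrence determines the maps because $t_{n-1}(X_1,\dots,X_n)$ occurs only in the term of the one-block partition, with nonzero coefficient $\prod_{l=2}^n t_0(X_l)$. *)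

(* Defs.v *)
From mathcomp Require Import all_boot all_order all_algebra.
From mathcomp Require Import reals complex.

Set Implicit Arguments.
Unset Strict Implicit.
Unset Printing Implicit Defensive.

Import GRing.Theory.
Local Open Scope ring_scope.

Definition free_family (K : fieldType) (A : algType K) (phi : {scalar A})
    (I : Type) (S : I -> {pred A}) : Prop :=
  forall (n : nat) (e : 'I_n.+1 -> I) (a : 'I_n.+1 -> A),
    (forall k, a k \in S (e k)) ->
    (forall j k : 'I_n.+1, k = j.+1 :> nat -> e j <> e k) ->
    (forall k, phi (a k) = 0) ->
    phi (\prod_(k < n.+1) a k) = 0.

Definition is_min n (B : {set 'I_n}) (j : 'I_n) : bool :=
  (j \in B) && [forall k in B, (j <= k)%N].

Definition crossing n (B C : {set 'I_n}) : bool :=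
  [exists i in B, exists m in C, exists p in B, exists q in C,
    [&& (i < m)%N, (m < p)%N & (p < q)%N]].

Definition linked n (B C : {set 'I_n}) : bool :=
  [exists j, [&& B :&: C == [set j], (2 <= #|B|)%N, (2 <= #|C|)%N
               & is_min B j (+) is_min C j]].

Definition NCL n : {set {set {set 'I_n}}} :=
  [set P : {set {set 'I_n}} |
    [&& set0 \notin P,
        cover P == [set: 'I_n],
        [forall B in P, forall C in P, (B != C) ==> ~~ crossing B C]
      & [forall B in P, forall C in P,
          (B != C) ==> (B :&: C == set0) || linked B C]]].

Definition ncl_s n (P : {set {set 'I_n}}) : {set 'I_n} :=
  [set k | [forall B in P, ~~ is_min B k]].

(* The family (t_n) is encoded by one function on sequences:
   t [:: X_1; ...; X_n] stands for t_(n-1)(X_1, ..., X_n).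
   [enum B] lists the elements of B in increasing order. *)
Definition ncl_weight (K : fieldType) (A : algType K) (t : seq A -> K)
    n (X : 'I_n -> A) (P : {set {set 'I_n}}) : K :=
  (\prod_(B in P) t [seq X i | i <- enum B]) *
  \prod_(k in ncl_s P) t [:: X k].

(* The values of t are only meaningful, and only constrained, on sequences
   whose entries other than the first lie outside the kernel of phi; there
   they are uniquely determined (is_tcoef_uniq below), and such a t always
   exists (is_tcoef_exists). *)
Definition is_tcoef (K : fieldType) (A : algType K) (phi : {scalar A})
    (t : seq A -> K) : Prop :=
  forall (n : nat) (X : 'I_n.+1 -> A),
    (forall k : 'I_n.+1, k != ord0 -> phi (X k) != 0) ->
    phi (\prod_(k < n.+1) X k) = \sum_(P in NCL n.+1) ncl_weight t X P.

Lemma ncl_top n : [set [set: 'I_n.+1]] \in NCL n.+1.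
Proof.
rewrite inE; apply/and4P; split.
- rewrite inE; apply/eqP => /setP/(_ ord0); rewrite !inE; exact.
- by rewrite /cover big_set1.
- by apply/forall_inP => B /set1P ->; apply/forall_inP => C /set1P ->; rewrite eqxx.
- by apply/forall_inP => B /set1P ->; apply/forall_inP => C /set1P ->; rewrite eqxx.
Qed.

Lemma ncl_proper n (P : {set {set 'I_n.+1}}) B :
  P \in NCL n.+1 -> P != [set setT] -> B \in P -> (0 < #|B| <= n)%N.
Proof.
rewrite inE => /and4P[P0 _ _ /forall_inP PL] PT BP; apply/andP; split.
  by rewrite card_gt0; apply: contraNneq P0 => <-.
rewrite leqNgt; apply: contra PT => Bn.
have BT : B = setT.
  by apply/eqP; rewrite eqEcard subsetT cardsT card_ord.
move: BP; rewrite {}BT => BP {Bn}; apply/eqP/setP => C; rewrite inE.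
apply/idP/eqP => [CP|-> //]; apply/eqP/negPn/negP; rewrite eq_sym => TC.
have := implyP (forall_inP (PL _ BP) _ CP) TC; rewrite setTI => /orP[/eqP C0|].
  by rewrite C0 (negPf P0) in CP.
case/existsP => j /and4P[]; rewrite setTI => /eqP -> _.
by rewrite cards1.
Qed.

Lemma ncl_s_top n : ncl_s [set [set: 'I_n.+1]] = [set k | k != ord0].
Proof.
apply/setP => k; rewrite !inE; apply/forall_inP/idP => [/(_ setT)|k0 B /set1P ->].
  rewrite set11 => /(_ isT); apply: contra => /eqP ->.
  by rewrite /is_min inE; apply/forall_inP.
apply: contra k0 => /andP[_ /forall_inP/(_ ord0)]; rewrite inE leqn0.
exact.
Qed.

Lemma ncl_weight_top (K : fieldType) (A : algType K) (t : seq A -> K)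
    n (X : 'I_n.+1 -> A) :
  ncl_weight t X [set setT] =
  t [seq X k | k <- enum 'I_n.+1] * \prod_(k < n.+1 | k != ord0) t [:: X k].
Proof.
rewrite /ncl_weight big_set1 ncl_s_top; congr (t _ * _).
  by rewrite (eq_enum (in_setT (T := _))) .
by apply: eq_bigl => k; rewrite inE.
Qed.

Definition admissible (K : fieldType) (A : algType K) (phi : {scalar A})
    (s : seq A) : bool :=
  (0 < size s)%N && all (fun x => phi x != 0) (behead s).

Lemma admissible_block (K : fieldType) (A : algType K) (phi : {scalar A})
    n (X : 'I_n.+1 -> A) (B : {set 'I_n.+1}) :
  (forall k : 'I_n.+1, k != ord0 -> phi (X k) != 0) -> (0 < #|B|)%N ->
  admissible phi [seq X i | i <- enum B].
Proof.
move=> hX B0; rewrite /admissible size_map -cardE B0 /= behead_map all_map.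
apply/allP => k kB; apply: hX.
have eB : enum B = filter (mem B) (enum 'I_n.+1) by rewrite enumT.
move: kB; rewrite eB enum_ordSl /=.
have H (s : seq 'I_n) : k \in filter (mem B) (map (lift ord0) s) -> k != ord0.
  by rewrite mem_filter => /andP[_ /mapP[j _ ->]]; rewrite eq_sym neq_lift.
by case: ifP => _ /=; [|move=> /mem_behead]; exact: H.
Qed.

Lemma eq_ncl_weight (K : fieldType) (A : algType K) (phi : {scalar A})
    (t t' : seq A -> K) n (X : 'I_n.+1 -> A) (P : {set {set 'I_n.+1}}) :
  (forall s, admissible phi s -> (size s <= n)%N -> t s = t' s) ->
  (forall k : 'I_n.+1, k != ord0 -> phi (X k) != 0) ->
  P \in NCL n.+1 -> P != [set setT] ->
  ncl_weight t X P = ncl_weight t' X P.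
Proof.
move=> tt' hX PN PT; rewrite /ncl_weight; congr (_ * _).
  apply: eq_bigr => B BP; have /andP[B0 Bn] := ncl_proper PN PT BP.
  by apply: tt'; [exact: admissible_block | rewrite size_map -cardE].
have n0 : (0 < n)%N.
  move: (PN); rewrite inE => /and4P[_ /eqP Pc _ _].
  have : ord0 \in cover P by rewrite Pc in_setT.
  case/bigcupP => B BP _.
  by have /andP[] := ncl_proper PN PT BP; apply: leq_trans.
by apply: eq_bigr => k _; rewrite tt'.
Qed.

Lemma sum_ncl (K : fieldType) (A : algType K) (t : seq A -> K)
    n (X : 'I_n.+1 -> A) :
  \sum_(P in NCL n.+1) ncl_weight t X P =
  t [seq X k | k <- enum 'I_n.+1] * \prod_(k < n.+1 | k != ord0) t [:: X k] +
  \sum_(P in NCL n.+1 | P != [set setT]) ncl_weight t X P.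
Proof. by rewrite (bigD1 _ (ncl_top n)) /= ncl_weight_top. Qed.

Lemma sum_ncl1 (K : fieldType) (A : algType K) (t : seq A -> K)
    (X : 'I_1 -> A) :
  \sum_(P in NCL 1 | P != [set setT]) ncl_weight t X P = 0.
Proof.
apply: big1 => P /andP[PN PT]; move: (PN); rewrite inE => /and4P[_ /eqP Pc _ _].
have : ord0 \in cover P by rewrite Pc in_setT.
case/bigcupP => B BP _; have /andP[] := ncl_proper PN PT BP.
by case: #|_|.
Qed.

Lemma is_tcoef_t0 (K : fieldType) (A : algType K) (phi : {scalar A})
    (t : seq A -> K) (x : A) :
  is_tcoef phi t -> t [:: x] = phi x.
Proof.
move=> /(_ 0%N (fun=> x)); rewrite sum_ncl sum_ncl1 addr0 big_ord1.
rewrite enum_ordSl enum_ord0 /= big1 ?mulr1; last by move=> k; rewrite ord1.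
by move=> -> // k; rewrite ord1.
Qed.

Lemma map_nth_enum (T : Type) (x0 : T) (s : seq T) n :
  size s = n -> [seq nth x0 s k | k : 'I_n <- enum 'I_n] = s.
Proof.
move=> <-; rewrite (map_comp (nth x0 s) val) val_enum_ord.
exact: mkseq_nth.
Qed.

Lemma is_tcoef_uniq (K : fieldType) (A : algType K) (phi : {scalar A})
    (t t' : seq A -> K) :
  is_tcoef phi t -> is_tcoef phi t' ->
  forall s, admissible phi s -> t s = t' s.
Proof.
move=> ht ht' s; have [m] := ubnP (size s); elim: m s => // n IHn s sn /andP[s0 sA].
case: (ltnP (size s) n) => [/IHn->//|ns]; first by rewrite /admissible s0.
have {sn ns} sn : size s = n by apply/eqP; rewrite eqn_leq ns -ltnS sn.
case: n => [|n] in IHn sn *; first by rewrite sn in s0.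
pose X (k : 'I_n.+1) := nth 0 s k.
have hX (k : 'I_n.+1) : k != ord0 -> phi (X k) != 0.
  move=> k0; rewrite /X -[val k]prednK ?lt0n // -nth_behead.
  apply: (allP sA); rewrite mem_nth // size_behead sn /=.
  by rewrite -ltnS prednK ?lt0n.
have := ht' _ _ hX; rewrite (ht _ _ hX) !sum_ncl !map_nth_enum //.
rewrite [X in _ + X](@eq_bigr _ _ _ _ _ _ _ (ncl_weight t' X)); last first.
  by move=> P /andP[PN PT]; apply: eq_ncl_weight hX PN PT => u uA un; apply: IHn.
move/addIr.
rewrite (eq_bigr (fun k => t' [:: X k])) => [|k _]; last first.
  by rewrite !(is_tcoef_t0 (phi := phi)).
apply/mulIf/prodf_neq0 => k k0.
by rewrite (is_tcoef_t0 _ ht') hX.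
Qed.

Fixpoint tcoef_rec (K : fieldType) (A : algType K) (phi : {scalar A})
    (m : nat) (s : seq A) : K :=
  if m is n.+1 then
    if (size s <= n)%N then tcoef_rec phi n s else
    let X (k : 'I_n.+1) := nth 0 s k in
    (phi (\prod_(k < n.+1) X k) -
     \sum_(P in NCL n.+1 | P != [set setT]) ncl_weight (tcoef_rec phi n) X P) /
    \prod_(k < n.+1 | k != ord0) phi (X k)
  else 0.

Lemma is_tcoef_exists (K : fieldType) (A : algType K) (phi : {scalar A}) :
  exists t : seq A -> K, is_tcoef phi t.
Proof.
pose t s := tcoef_rec phi (size s) s; exists t.
have tE m s : (size s <= m)%N -> tcoef_rec phi m s = t s.
  elim: m => [|m IHm]; first by rewrite leqn0 => /eqP s0; rewrite /t s0.
  rewrite leq_eqVlt => /orP[/eqP sm|]; first by rewrite /t sm.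
  by rewrite ltnS => sm /=; rewrite sm IHm.
have t1 x : t [:: x] = phi x.
  rewrite /t /= sum_ncl1 subr0 big_ord1 /= big1 ?divr1 // => k.
  by rewrite ord1.
move=> n X hX; rewrite sum_ncl.
set s := [seq X k | k <- _].
have sn : size s = n.+1 by rewrite size_map size_enum_ord.
have sX (k : 'I_n.+1) : nth 0 s k = X k.
  by rewrite (nth_map ord0) ?size_enum_ord // nth_ord_enum.
rewrite (eq_bigr (fun k => phi (X k))) => [|k _]; last exact: t1.
rewrite /t sn /= sn ltnn -/t.
have XE : (fun k : 'I_n.+1 => nth 0 s k) =1 X by move=> k; rewrite sX.
rewrite [X in _ / X](eq_bigr (fun k => phi (X k))); last first.
  by move=> k _; rewrite sX.
rewrite divfK; last by apply/prodf_neq0 => k; exact: hX.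
rewrite -[LHS](subrK (\sum_(P in NCL n.+1 | P != [set setT]) ncl_weight t X P)).
congr (_ - _ + _).
  by congr (phi _); apply: eq_bigr => k _; rewrite sX.
apply: eq_bigr => P /andP[PN PT].
transitivity (ncl_weight (tcoef_rec phi n) X P).
  by apply: esym; apply: (eq_ncl_weight (phi := phi)) => // u _; apply: tE.
rewrite /ncl_weight; congr (_ * _); apply: eq_bigr => ? _; last by rewrite sX.
by congr (tcoef_rec _ _ _); apply: eq_map.
Qed.

(* Main.v *)
Require Import Defs.
From mathcomp Require Import all_boot all_order all_algebra.
From mathcomp Require Import reals complex boolp zify.

Set Implicit Arguments.
Unset Strict Implicit.
Unset Printing Implicit Defensive.
Import GRing.Theory.
Local Open Scope ring_scope.

(** Think of vectors [e_D], one for each word [D] of letters with nonzero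
expectation, on which a letter [x] acts by
  [x e_D = \sum_(D = C ++ B) t (x :: C) (e_B + e_(x :: B))]:
it removes a prefix of the stack [D] and then may or may not push itself.
Applying [x_1 ... x_n] to the vacuum [e_[::]] and keeping the vacuum
coefficient gives the sum over non-crossing linked partitions, because the
choices made by the letters are exactly the data of such a partition: the
prefix popped by [x_i] completes the block with minimum [i], and [x_i] is pushed
exactly when [i] is a non-minimal element of another block.

The proof uses this picture inside [A].  The element [wick D] is the one that
creates [e_D] from the vacuum; it is determined by the action above when
[t (x :: C)] is replaced by [phi (x * wick C)], a quantity that depends on
[phi] alone.  Wick elements of nonempty words are centred ([phi_wick]), and
expanding a product letter by letter shows that [phi (x * wick C)] satisfies the
recurrence of the t-coefficients, hence equals [t (x :: C)] by uniqueness
([tcoef_wick]).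

Both implications rest on one factorization ([wick_cat]): if mixed coefficients
vanish, then [wick (U ++ V) = wick U * wick V] as soon as [U] has a single colour
and [V] does not start with it, since a letter of that colour cannot pop
beyond [U].

If mixed coefficients vanish and [a_1 ... a_n] is alternating and centred, then
[a_k = wick [:: a_k + 1]], so the factorization turns the product into
[wick [:: a_1 + 1; ...; a_n + 1]], which is centred.

If the algebras are free, mixed coefficients vanish by induction on the length:
for shorter words the factorization holds, so [wick D] is the alternating
product of the centred elements [wick D_i] of its monochromatic runs, and
freeness kills [phi (x * wick D)]. *)

(** * Wick elements *)

Section Wick.
Variables (K : fieldType) (A : algType K) (phi : {scalar A}).

(** The recursion for [x :: D] calls prefixes and suffixes of [D] and shorter
words starting with [x], hence the bound [n] on the length.  The formula is the
identity [mulr_wick] solved for its term [wick (x :: D)]. *)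
Fixpoint wick_rec (n : nat) (w : seq A) : A :=
  if n is n'.+1 then
    if w is x :: D then
      (phi x)^-1 *: (x * wick_rec n' D
         - \sum_(k < size D) phi (x * wick_rec n' (take k.+1 D)) *:
             (wick_rec n' (drop k.+1 D) + wick_rec n' (x :: drop k.+1 D)))
      - wick_rec n' D
    else 1
  else 1.

Definition wick (w : seq A) : A := wick_rec (size w) w.

Lemma wick_recE n w : (size w <= n)%N -> wick_rec n w = wick w.
Proof.
rewrite /wick; have [m] := ubnP (size w).
elim: m n w => // m IH [|n] [|x D] //=; rewrite !ltnS => Dm Dn.
have E v : (size v <= size D)%N -> wick_rec n v = wick_rec (size D) v.
  move=> vD; have vm := leq_ltn_trans vD Dm.
  by rewrite (IH n) ?(IH (size D)) // (leq_trans vD Dn).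
rewrite !E //; congr (_ *: (_ - _) - _).
apply: eq_bigr => k _; have kD := ltn_ord k.
by rewrite !E //= ?size_takel // ?size_drop; lia.
Qed.

Lemma wick_nil : wick [::] = 1. Proof. by []. Qed.

Lemma wick_cons x D : wick (x :: D) =
  (phi x)^-1 *: (x * wick D - \sum_(k < size D) phi (x * wick (take k.+1 D)) *:
     (wick (drop k.+1 D) + wick (x :: drop k.+1 D))) - wick D.
Proof.
rewrite {1}/wick /=; congr (_ *: (_ - _) - _).
apply: eq_bigr => k _; have kD := ltn_ord k.
by rewrite !wick_recE //= ?size_takel // ?size_drop; lia.
Qed.

Lemma wick1 x : wick [:: x] = (phi x)^-1 *: x - 1.
Proof. by rewrite wick_cons big_ord0 wick_nil subr0 mulr1. Qed.

(** The action of a letter on the vector [e_D] of the stack model. *)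
Lemma mulr_wick x D : phi x != 0 -> x * wick D =
  \sum_(k < (size D).+1) phi (x * wick (take k D)) *:
     (wick (drop k D) + wick (x :: drop k D)).
Proof.
move=> x0; rewrite big_ord_recl /= take0 drop0 wick_nil mulr1.
rewrite [wick (x :: D)]wick_cons [wick D + _]addrC subrK scalerA divff //.
by rewrite scale1r subrK.
Qed.

Hypothesis phi1 : phi 1 = 1.

(** Solve [mulr_wick] for [phi (wick (x :: D))].  By induction only the pop of
all of [D] contributes to the sum, through [wick [::] = 1], and its contribution
is [phi (x * wick D)]. *)
Lemma phi_wick w : all (fun x => phi x != 0) w -> w != [::] -> phi (wick w) = 0.
Proof.
have [m] := ubnP (size w); elim: m w => // m IH [|x D] //=.
rewrite ltnS => Dm /andP[x0 D0] _.
have s0 k : all (fun x => phi x != 0) (drop k D).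
  by apply/allP => y /mem_drop; exact: (allP D0).
rewrite wick_cons raddfB /= scalarZ /= raddfB raddf_sum /=.
case: D => [|y D] in Dm D0 s0 *.
  by rewrite big_ord0 subr0 wick_nil mulr1 phi1 mulVf // subrr.
rewrite [phi (wick (y :: D))]IH // subr0.
rewrite -[size (y :: D)]/(size D).+1 big_ord_recr /= big1 => [|k _]; last first.
  have kD := ltn_ord k; rewrite /= in Dm.
  rewrite /= scalarZ /= raddfD /= (IH (drop k D)) ?(IH (x :: drop k D)) ?addr0 ?mulr0 //=.
  - by rewrite size_drop; lia.
  - by rewrite x0; exact: (s0 k.+1).
  - by rewrite size_drop; lia.
  - exact: (s0 k.+1).
  - by rewrite -size_eq0 size_drop -lt0n subn_gt0.
rewrite take_size drop_size add0r wick_nil wick1 addrCA subrr addr0.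
by rewrite !scalarZ mulVf // mulr1 subrr mulr0.
Qed.

End Wick.

(** * Non-crossing linked partitions as parent functions *)

Section Parent.
Local Open Scope nat_scope.
Variable n : nat.
Implicit Types (p : {ffun 'I_n -> 'I_n}) (P : {set {set 'I_n}}) (B C : {set 'I_n}).

(** A linked partition is recorded by the function sending [k] to the minimum of
the unique block in which [k] is not minimal, and to [k] itself if there is
none.  With this convention for roots, noncrossing is the second condition of
[nested], with no separate case for roots. *)
Definition children p j : {set 'I_n} := [set k | (p k == j) && (k != j)].
Definition nested p : bool :=
  [forall k, p k <= k] &&
  [forall k : 'I_n, forall l : 'I_n, (k < l) ==> (p l <= p k) || (k <= p l)].
Definition block p j : {set 'I_n} := j |: children p j.
(** The minima of the blocks; a [k] outside this set is a non-minimal element of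
one block and opens none, so it belongs to [ncl_s]. *)
Definition openers p : {set 'I_n} :=
  [set j | (p j == j) || (children p j != set0)].
Definition blocks p : {set {set 'I_n}} := [set block p j | j in openers p].
Definition parent P : {ffun 'I_n -> 'I_n} :=
  [ffun k => odflt k
     [pick j | [exists B in P, [&& is_min B j, k \in B & k != j]]]].

Lemma nestedP p :
  reflect ((forall k, p k <= k) /\
           (forall k l : 'I_n, k < l -> (p l <= p k) || (k <= p l)))
          (nested p).
Proof.
apply: (iffP andP) => -[H1 H2]; split.
- exact/forallP.
- by move=> k l; apply/implyP; move/forallP/(_ k)/forallP: H2.
- exact/forallP.
- by apply/forallP => k; apply/forallP => l; apply/implyP/H2.
Qed.

Lemma is_minP B j : reflect (j \in B /\ forall k, k \in B -> j <= k) (is_min B j).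
Proof.
apply: (iffP andP) => -[jB H]; split=> //; last exact/forall_inP.
exact: (forall_inP H).
Qed.

Lemma is_min_uniq B i j : is_min B i -> is_min B j -> i = j.
Proof.
move=> /is_minP[iB mi] /is_minP[jB mj]; apply/val_inj/eqP.
by rewrite eqn_leq mi ?mj.
Qed.

Lemma is_min_exists B : B != set0 -> exists j, is_min B j.
Proof.
case/set0Pn => i iB; case: (arg_minnP (fun k : 'I_n => val k) iB) => j jB jm.
by exists j; apply/is_minP; split.
Qed.

Lemma in_block p j k : (k \in block p j) = (k == j) || (p k == j).
Proof. by rewrite !inE; case: (k == j); rewrite ?andbT. Qed.

Lemma min_block p j : nested p -> is_min (block p j) j.
Proof.
case/nestedP => pk _; apply/is_minP; rewrite in_block eqxx; split=> // k.
by rewrite in_block => /orP[] /eqP <-.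
Qed.

Lemma min_blockE p i j : nested p -> is_min (block p i) j = (i == j).
Proof.
move=> np; apply/idP/eqP => [|<-]; last exact: min_block.
exact/is_min_uniq/min_block.
Qed.

Lemma block_inj p : nested p -> injective (block p).
Proof. by move=> np i j E; apply/eqP; rewrite -(min_blockE _ _ np) E min_block. Qed.

Lemma crossing_block p i j : nested p -> i != j -> ~~ crossing (block p i) (block p j).
Proof.
case/nestedP => pk nc ij; apply/existsP => -[a /andP[ai /existsP[b /andP[bj]]]].
case/existsP => c /andP[ci /existsP[d /andP[dj /and3P[ab bc cd]]]].
move: ai bj ci dj; rewrite !in_block -!val_eqE /= => ai bj ci dj.
have := nc _ _ cd; have := nc _ _ bc; have := pk a; have := pk b.
by move: ij; rewrite -val_eqE /=; lia.
Qed.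

Lemma linkedC B C : linked B C = linked C B.
Proof.
apply: eq_existsb => j; rewrite setIC addbC; congr (_ && _).
by rewrite andbCA.
Qed.

(** If [i] has a parent and opens a block, it is the link between the two. *)
Lemma linked_block p i : nested p -> p i != i -> i \in openers p ->
  linked (block p i) (block p (p i)).
Proof.
move=> np pi; rewrite inE (negPf pi) /= => /set0Pn[k ki].
have [pk _] := nestedP _ np; have := pk i => pii.
have ki' : k != i by move: ki; rewrite inE => /andP[].
apply/existsP; exists i; apply/and4P; split.
- apply/eqP/setP => y; rewrite in_set1 inE !in_block.
  apply/idP/eqP => [|->]; last by rewrite !eqxx orbT.
  case/andP => /orP[/eqP->//|/eqP yi] /orP[] /eqP yE; last by rewrite -yE yi eqxx in pi.
  by have := pk y; rewrite yi yE => ii; case/eqP: pi; apply/val_inj/eqP; rewrite eqn_leq ii pii.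
- apply/card_gt1P; exists i, k; split; rewrite ?in_block ?eqxx //; last by rewrite eq_sym.
  by move: ki; rewrite inE => /andP[->]; rewrite orbT.
- by apply/card_gt1P; exists (p i), i; split; rewrite ?in_block ?eqxx ?orbT.
- by rewrite !min_blockE // eqxx (negPf pi).
Qed.

Lemma blocks_NCL p : nested p -> blocks p \in NCL n.
Proof.
move=> np; rewrite inE; apply/and4P; split.
- apply/imsetP => -[j _ E]; have := in_block p j j.
  by rewrite -E inE eqxx.
- apply/eqP/setP => k; rewrite [in RHS]inE; apply/bigcupP.
  have [pk|pk] := eqVneq (p k) k.
    by exists (block p k); rewrite ?in_block ?eqxx // imset_f // inE pk eqxx.
  exists (block p (p k)); rewrite ?in_block ?eqxx ?orbT // imset_f // inE.
  by apply/orP; right; apply/set0Pn; exists k; rewrite inE eqxx eq_sym.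
- apply/forall_inP => B /imsetP[i _ ->]; apply/forall_inP => C /imsetP[j _ ->].
  by apply/implyP; rewrite (inj_eq (block_inj np)); apply: crossing_block.
- apply/forall_inP => B /imsetP[i iJ ->]; apply/forall_inP => C /imsetP[j jJ ->].
  apply/implyP; rewrite (inj_eq (block_inj np)) => ij.
  have [//|[y]] := set_0Vmem (block p i :&: block p j); first by move=> ->; rewrite eqxx.
  rewrite inE !in_block => /andP[/orP[] /eqP yi /orP[] /eqP yj].
  + by rewrite -yi yj eqxx in ij.
  + by subst y j; rewrite linked_block ?orbT // eq_sym.
  + by subst y i; rewrite linkedC linked_block ?orbT.
  + by rewrite -yi yj eqxx in ij.
Qed.

Lemma blocksK p : nested p -> parent (blocks p) = p.
Proof.
move=> np; apply/ffunP => k; rewrite ffunE.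
have E j : [exists B in blocks p, [&& is_min B j, k \in B & k != j]]
           = (p k == j) && (k != j).
  apply/existsP/andP => [[B /andP[/imsetP[i _ ->]]]|[/eqP pk kj]].
    rewrite min_blockE // in_block => /and3P[/eqP <-].
    by case: (k == i).
  exists (block p j); rewrite min_blockE // eqxx in_block pk eqxx orbT kj.
  rewrite imset_f // inE; apply/orP; right; apply/set0Pn; exists k.
  by rewrite inE pk eqxx.
case: pickP => [j|/(_ (p k))]; rewrite E; first by case/andP => /eqP.
by rewrite eqxx /= => /negbFE/eqP.
Qed.

Section OfNCL.
Variable P : {set {set 'I_n}}.
Hypothesis PN : P \in NCL n.

Lemma NCL_link B C : B \in P -> C \in P -> B != C -> B :&: C != set0 -> linked B C.
Proof.
move: PN; rewrite inE => /and4P[_ _ _ /forall_inP H] /H /forall_inP H' /H' /implyP H'' /H''.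
by case/orP => // /eqP ->; rewrite eqxx.
Qed.

(** A shared point of two distinct blocks is minimal in exactly one of them.
Hence no two blocks have the same minimum, and no point is non-minimal in two
blocks, which is what makes [parent] well defined. *)
Lemma NCL_eq_block B C j : B \in P -> C \in P -> j \in B -> j \in C ->
  is_min B j = is_min C j -> B = C.
Proof.
move=> BP CP jB jC E; apply/eqP/negPn/negP => BC.
have BC0 : B :&: C != set0 by apply/set0Pn; exists j; rewrite inE jB.
have /existsP[i /and4P[/eqP Ei _ _]] := NCL_link BP CP BC BC0.
have : j \in B :&: C by rewrite inE jB.
by rewrite Ei => /set1P <-; rewrite E addbb.
Qed.

Lemma parent_child B j k : B \in P -> is_min B j -> k \in B -> k != j ->
  parent P k = j.
Proof.
move=> BP Bj kB kj; rewrite ffunE; case: pickP => [i|/(_ j)]; last first.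
  by case/existsP; exists B; rewrite BP Bj kB.
case/existsP => C /and4P[CP Ci kC ki] /=.
suff BC : B = C by apply: is_min_uniq Ci _; rewrite -BC.
apply: NCL_eq_block (kB) (kC) _ => //.
by apply/idP/idP => mk; [case/eqP: kj|case/eqP: ki]; apply: is_min_uniq mk _.
Qed.

Lemma parent_root k : parent P k = k -> forall B, B \in P -> k \in B -> is_min B k.
Proof.
move=> pk B BP kB; have [j Bj] : exists j, is_min B j.
  by apply/is_min_exists/set0Pn; exists k.
have [->//|kj] := eqVneq k j.
by move: (kj); rewrite -(parent_child BP Bj kB kj) pk eqxx.
Qed.

Lemma parent_block k : parent P k != k ->
  exists B, [/\ B \in P, is_min B (parent P k) & k \in B].
Proof.
rewrite ffunE; case: pickP => [j /existsP[B /and4P[BP Bj kB kj]] _|_]; last by rewrite eqxx.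
by exists B.
Qed.

Lemma nested_parent : nested (parent P).
Proof.
apply/nestedP; split=> [k|k l kl].
  have [->//|/parent_block[B [_ /is_minP[_ H] /H]]] := eqVneq (parent P k) k.
  by [].
apply/negPn/negP; rewrite negb_or -!ltnNge => /andP[kq qk].
have lq : parent P l != l by rewrite -val_eqE /=; lia.
have ki : parent P k != k by rewrite -val_eqE /=; lia.
have [B [BP Bm lB]] := parent_block lq; have [C [CP Cm kC]] := parent_block ki.
have CB : C != B.
  apply: contraTneq kq => E.
  by rewrite (@is_min_uniq B (parent P k) (parent P l)) ?ltnn // -E.
have : ~~ crossing C B.
  by move: PN; rewrite inE => /and4P[_ _ /forall_inP/(_ C CP)/forall_inP/(_ B BP)/implyP/(_ CB)].
case/existsP; exists (parent P k); have /is_minP[-> _] := Cm.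
apply/existsP; exists (parent P l); have /is_minP[-> _] := Bm.
apply/existsP; exists k; rewrite kC; apply/existsP; exists l.
by rewrite lB kq qk.
Qed.

Lemma NCL_block B j : B \in P -> is_min B j -> B = block (parent P) j.
Proof.
move=> BP Bj; apply/setP => k; rewrite in_block.
have [->|kj] := eqVneq k j; first by case/is_minP: Bj.
apply/idP/eqP => [kB|pk]; first exact: parent_child Bj kB kj.
have : parent P k != k by rewrite pk eq_sym.
case/parent_block => C [CP]; rewrite pk => Cj kC.
by rewrite (@NCL_eq_block B C j) ?Bj ?Cj //; [case/is_minP: Bj|case/is_minP: Cj].
Qed.

(** An opener of [parent P] is the minimum of a block of [P].  Conversely the
minimum [j] of a block is an opener: otherwise the block is [[set j]] and [j] is
non-minimal in another block, but linked blocks have at least two elements. *)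
Lemma parentK : blocks (parent P) = P.
Proof.
have [P0 cP] : set0 \notin P /\ cover P = setT.
  by move: PN; rewrite inE => /and4P[? /eqP].
apply/setP => B; apply/imsetP/idP => [[j jJ ->]|BP].
  suff [C CP Cj] : exists2 C, C \in P & is_min C j by rewrite -(NCL_block CP).
  move: jJ; rewrite inE => /orP[/eqP pj|/set0Pn[k]].
    have /bigcupP[C CP jC] : j \in cover P by rewrite cP inE.
    by exists C => //; apply: parent_root.
  rewrite inE => /andP[/eqP pk kj]; have : parent P k != k by rewrite pk eq_sym.
  by case/parent_block => C []; rewrite pk; exists C.
have [j Bj] : exists j, is_min B j.
  by apply: is_min_exists; apply: contraNneq P0 => <-.
exists j; last exact: NCL_block.
rewrite inE; apply/negPn/negP; rewrite negb_or negbK => /andP[pj /eqP ch0].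
have [C [CP Cm jC]] := parent_block pj.
have EB : B = [set j] by rewrite (NCL_block BP Bj) /block ch0 setU0.
have BC : B != C.
  apply: contraNneq pj => E.
  by apply/eqP/(@is_min_uniq B) => //; rewrite E.
have : linked B C.
  by apply: NCL_link => //; apply/set0Pn; exists j; rewrite EB !inE eqxx.
by case/existsP => i /and4P[_]; rewrite EB cards1.
Qed.

End OfNCL.

Lemma sorted_enum_ord B : sorted (fun i j : 'I_n => i < j) (enum B).
Proof.
rewrite {1}/enum_mem -enumT; apply: sorted_filter; first by move=> ? ? ?; apply: ltn_trans.
by have := iota_ltn_sorted 0 n; rewrite -val_enum_ord sorted_map.
Qed.

Lemma enum_sorted (s : seq 'I_n) : sorted (fun i j : 'I_n => i < j) s ->
  enum [set i in s] = s.
Proof.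
move=> ss; apply: (@irr_sorted_eq _ (fun i j : 'I_n => i < j)) => //.
- by move=> ? ? ?; apply: ltn_trans.
- by move=> i; rewrite ltnn.
- exact: sorted_enum_ord.
- by move=> i; rewrite mem_enum inE.
Qed.

Lemma enum_block p j : nested p -> enum (block p j) = j :: enum (children p j).
Proof.
case/nestedP => pk _; rewrite -[RHS]enum_sorted; last first.
  rewrite /= path_min_sorted ?sorted_enum_ord //; apply/allP => k.
  by rewrite mem_enum inE -val_eqE -(val_eqE k) /=; have := pk k; lia.
by apply: eq_enum => k; rewrite in_block !inE mem_enum inE; case: eqP => //=; rewrite andbT.
Qed.

End Parent.

(** The factors of [ncl_s] become blocks with an empty tail, so that the weight
is a uniform product over positions. *)
Lemma ncl_weight_blocks (K : fieldType) (A : algType K) (t : seq A -> K) n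
    (X : 'I_n -> A) (p : {ffun 'I_n -> 'I_n}) : nested p ->
  ncl_weight t X (blocks p) = \prod_j t (X j :: [seq X k | k <- enum (children p j)]).
Proof.
move=> np; rewrite /ncl_weight big_imset /=; last by move=> i j _ _; apply: block_inj.
rewrite [RHS](bigID (mem (openers p))) /=; congr (_ * _).
  by apply: eq_bigr => j _; rewrite enum_block.
apply: eq_big => [k|k kp].
  rewrite !inE; apply/forall_inP/idP => [H|kJ B /imsetP[j jJ ->]].
    apply/negP => kJ; have /H : block p k \in blocks p by rewrite imset_f // inE.
    by rewrite min_block.
  by rewrite min_blockE //; apply: contraNneq kJ => <-; rewrite inE in jJ.
have : k \notin openers p.
  apply/negP => kJ; move: kp; rewrite inE => /forall_inP/(_ (block p k)).
  by rewrite min_block // imset_f // => /(_ isT).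
by rewrite inE negb_or negbK => /andP[_ /eqP ->]; rewrite enum_set0.
Qed.

Lemma sum_ncl_nested (K : fieldType) (A : algType K) (t : seq A -> K) n
    (X : 'I_n -> A) :
  \sum_(P in NCL n) ncl_weight t X P =
  \sum_(p : {ffun 'I_n -> 'I_n} | nested p)
     \prod_j t (X j :: [seq X k | k <- enum (children p j)]).
Proof.
rewrite (reindex_onto (@blocks n) (@parent n)) /=; last by move=> P; apply: parentK.
apply: eq_big => [p|p /andP[PN /eqP pE]]; last first.
  by apply: ncl_weight_blocks; rewrite -pE nested_parent.
apply/andP/idP => [[PN /eqP <-]|np]; first exact: nested_parent.
by rewrite blocks_NCL ?blocksK.
Qed.

(** * Reading one letter: the transfer between configurations *)

(** The configurations left after reading the letters at positions above [m],
from right to left: those letters choose their children among themselves, and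
the pushed letters not yet popped, the stack, are recorded as the children of
the still unread position [m]. *)
Definition parents_from n (m : nat) (p : {ffun 'I_n -> 'I_n}) : bool :=
  [forall k, (m <= p k)%N || (p k == k)].

Section Step.
Local Open Scope nat_scope.
Variables (n : nat) (m' m : 'I_n).
Hypothesis m'm : m = m'.+1 :> nat.
Implicit Types p : {ffun 'I_n -> 'I_n}.

(** Undoes the reading of the letter [m]: the children of [m] go back on the
stack with those of [m'], and [m] leaves it. *)
Definition merge_stack p : {ffun 'I_n -> 'I_n} :=
  [ffun k => if k == m then m else if (p k == m') && (k != m') then m else p k].

(** The letter [m] pops the first [i] elements of the stack and, if [b], is
pushed itself; the stack becomes the set of children of [m']. *)
Definition split_stack p (i : nat) (b : bool) : {ffun 'I_n -> 'I_n} :=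
  [ffun k => if k == m then (if b then m' else m) else
     if k \in children p m then
       if index k (enum (children p m)) < i then m else m'
     else p k].

Lemma merge_stack_nested p : nested p -> parents_from m' p -> nested (merge_stack p).
Proof.
move=> /nestedP[pk nc] /forallP rf; apply/nestedP; split=> [k|k l kl].
  rewrite !ffunE; have := pk k; have := rf k; rewrite -!val_eqE /=.
  by repeat case: ifP => /=; lia.
rewrite !ffunE; have := pk k; have := rf k; have := pk l; have := rf l.
have := nc _ _ kl; rewrite -!val_eqE /=.
by repeat case: ifP => /=; lia.
Qed.

Lemma merge_stack_from p : nested p -> parents_from m' p -> parents_from m (merge_stack p).
Proof.
move=> /nestedP[pk nc] /forallP rf; apply/forallP => k.
rewrite !ffunE; have := pk k; have := rf k; rewrite -!val_eqE /=.
by repeat case: ifP => /=; lia.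
Qed.

(** Popping a prefix, rather than an arbitrary subset, of the stack is what
preserves noncrossing. *)
Lemma split_stack_nested p i b : nested p -> parents_from m p -> nested (split_stack p i b).
Proof.
move=> /nestedP[pk nc] /forallP rf; apply/nestedP; split=> [k|k l kl].
  rewrite !ffunE !inE; have := pk k; have := rf k; rewrite -!val_eqE /=.
  by repeat case: ifP => /=; lia.
have mono : k \in children p m -> l \in children p m ->
    index l (enum (children p m)) < i -> index k (enum (children p m)) < i.
  move=> kD lD li; rewrite ltnNge; apply/negP => ik.
  have tr : transitive (fun i j : 'I_n => i < j) by move=> ? ? ?; apply: ltn_trans.
  have := sorted_ltn_index tr (sorted_enum_ord (children p m)).
  rewrite -(mem_enum (children p m)) in kD; rewrite -(mem_enum (children p m)) in lD.
  move=> /(_ _ _ lD kD (leq_trans li ik)).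
  by rewrite ltnNge ltnW.
move: mono; rewrite !ffunE !inE; have := pk k; have := rf k; have := pk l; have := rf l.
have := nc _ _ kl; rewrite -!val_eqE /=.
by repeat case: ifP => /=; lia.
Qed.

Lemma split_stack_from p i b : nested p -> parents_from m p -> parents_from m' (split_stack p i b).
Proof.
move=> /nestedP[pk nc] /forallP rf; apply/forallP => k.
rewrite !ffunE !inE; have := pk k; have := rf k; rewrite -!val_eqE /=.
by repeat case: ifP => /=; lia.
Qed.

Lemma split_stackK p i b : nested p -> parents_from m p -> merge_stack (split_stack p i b) = p.
Proof.
move=> /nestedP[pk nc] /forallP rf; apply/ffunP => k.
rewrite !ffunE !inE; have := pk k; have := rf k => H1 H2; apply/val_inj.
move: H1 H2; rewrite -!val_eqE /=.
by repeat case: ifP => /=; lia.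
Qed.

Lemma enum_children_split p i b : nested p -> parents_from m p ->
  enum (children (split_stack p i b) m) = take i (enum (children p m)).
Proof.
move=> /nestedP[pk nc] /forallP rf.
rewrite -[RHS]enum_sorted ?take_sorted ?sorted_enum_ord //.
apply: eq_enum => k; rewrite !inE; have kE : (k \in children p m) = (p k == m) && (k != m).
  by rewrite inE.
case: (boolP (k \in children p m)) => kD; last first.
  rewrite [RHS](contraNF _ kD) => [|/mem_take]; last by rewrite mem_enum.
  rewrite ffunE (negPf kD); have [_|km] := eqVneq k m; first by rewrite andbF.
  by move: kE; rewrite km (negPf kD) => <-.
rewrite in_take ?mem_enum // ffunE kD.
move: kE; rewrite kD -!val_eqE /= => /esym; by repeat case: ifP => /=; lia.
Qed.

Lemma enum_stack_split p i b : nested p -> parents_from m p ->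
  enum (children (split_stack p i b) m') =
  if b then m :: drop i (enum (children p m)) else drop i (enum (children p m)).
Proof.
move=> /nestedP[pk nc] /forallP rf; set s := enum (children p m).
have ds : sorted (fun i j : 'I_n => i < j) (drop i s) by rewrite drop_sorted ?sorted_enum_ord.
have mD k : k \in drop i s = (k \in children p m) && (i <= index k s).
  apply/idP/andP => [kd|[kD]].
    have ks := mem_drop kd; split; first by rewrite mem_enum in ks.
    rewrite leqNgt -in_take //; apply/negP => kt.
    have : uniq (take i s ++ drop i s) by rewrite cat_take_drop enum_uniq.
    by rewrite cat_uniq => /and3P[_ /hasPn/(_ k kd)]; rewrite /= kt.
  rewrite -(mem_enum (children p m)) in kD; rewrite leqNgt -in_take // => kt.
  have : k \in take i s ++ drop i s by rewrite cat_take_drop.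
  by rewrite mem_cat (negPf kt).
rewrite -[RHS]enum_sorted; last first.
  case: b => //=; rewrite path_min_sorted //; apply/allP => k.
  rewrite mD => /andP[+ _]; rewrite inE -!val_eqE /=; have := pk k; lia.
apply: eq_enum => k.
have -> : (k \in [set i0 in if b then m :: drop i s else drop i s]) =
          (b && (k == m)) || (k \in children p m) && (i <= index k s).
  by case: (b); rewrite inE ?in_cons mD.
rewrite !inE !ffunE !inE /s; have := pk k; have := rf k; rewrite -!val_eqE /=.
move: (index k _) => ix; by repeat case: ifP => /=; lia.
Qed.

(** By noncrossing, the elements popped by [m] precede all those that stay on
the stack, so the popped set is a prefix. *)
Lemma enum_children_merge p : nested p -> parents_from m' p ->
  enum (children (merge_stack p) m) =
  enum (children p m) ++ enum (children p m' :\ m).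
Proof.
move=> /nestedP[pk nc] /forallP rf.
have tr : transitive (fun i j : 'I_n => i < j) by move=> ? ? ?; apply: ltn_trans.
rewrite -[RHS]enum_sorted; last first.
  rewrite sorted_pairwise // pairwise_cat -!sorted_pairwise // !sorted_enum_ord !andbT.
  apply/allrelP => a b; rewrite !mem_enum !inE; have := nc b a; have := pk b.
  have [->|] := eqVneq a b; rewrite -!val_eqE /=; lia.
apply: eq_enum => k; rewrite !inE mem_cat !mem_enum !inE !ffunE.
have := pk k; rewrite -!val_eqE /=; by repeat case: ifP => /=; lia.
Qed.

Lemma merge_stackK p : nested p -> parents_from m' p ->
  split_stack (merge_stack p) #|children p m| (p m == m') = p.
Proof.
move=> np rp; have [pk nc] := nestedP _ np; have rf := forallP rp.
apply/ffunP => k; apply/val_inj; rewrite ffunE enum_children_merge // cardE index_cat.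
have kE := mem_enum (children p m) k.
rewrite kE !inE !ffunE; have := pk k; have := rf k.
have := index_mem k (enum (children p m)); rewrite kE inE; move: (index _ _) => ix.
have [->|km] := eqVneq k m; first by rewrite -!val_eqE /=; repeat case: ifP => /=; lia.
move: (index _ _) => iy; move: km.
rewrite -!val_eqE /=; by repeat case: ifP => /=; lia.
Qed.

Lemma children_merge p (j : 'I_n) : nested p -> parents_from m' p -> m < j ->
  children (merge_stack p) j = children p j.
Proof.
move=> /nestedP[pk nc] /forallP rf mj; apply/setP => k.
rewrite !inE !ffunE; have := pk k; have := rf k; rewrite -!val_eqE /=.
by repeat case: ifP => /=; lia.
Qed.

End Step.

Section Expansion.
Variables (K : fieldType) (A : algType K) (phi : {scalar A}).
Variables (n : nat) (X : 'I_n -> A).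
Implicit Types (p : {ffun 'I_n -> 'I_n}) (m j : 'I_n).

Definition child_word p j := [seq X k | k <- enum (children p j)].

(** The product of the coefficients of the letters read so far, with
[phi (x * wick w)] standing for [t (x :: w)]. *)
Definition config_weight p m : K :=
  \prod_(j < n | (m < j)%N) phi (X j * wick phi (child_word p j)).

(** The configurations that [merge_stack] sends to [p] correspond to the choices
of a pop length [i] and a push bit [b], which are the terms of [mulr_wick]. *)
Lemma sum_merge_fibre p m' m : m = m'.+1 :> nat -> phi (X m) != 0 ->
  nested p -> parents_from m p ->
  \sum_(q | [&& nested q, parents_from m' q & merge_stack m' m q == p])
     config_weight q m' *: wick phi (child_word q m') =
  config_weight p m *: (X m * wick phi (child_word p m)).
Proof.
move=> mm Xm np rp; have m'm : m' != m by rewrite -val_eqE /= mm; lia.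
set D := children p m; pose N := #|D|.
have fibre q : [&& nested q, parents_from m' q & merge_stack m' m q == p] ->
    split_stack m' m p (inord #|children q m| : 'I_N.+1) (q m == m') = q.
  (* At most all of the stack [D] is popped, so [inord] does not truncate. *)
  case/and3P => nq rq /eqP mq; rewrite inordK -?mq ?merge_stackK //.
  by rewrite ltnS /N /D -mq !cardE enum_children_merge // size_cat leq_addr.
rewrite (reindex_onto (fun u : 'I_N.+1 * bool => split_stack m' m p u.1 u.2)
  (fun q => (inord #|children q m| : 'I_N.+1, q m == m'))) /=; last exact: fibre.
rewrite (eq_bigl xpredT) => [|[i b]] /=; last first.
  rewrite split_stack_nested ?split_stack_from ?split_stackK // eqxx /=.
  apply/eqP; congr pair; last first.
    by rewrite ffunE eqxx; case: b; rewrite ?eqxx // eq_sym (negPf m'm).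
  apply/val_inj; rewrite /= cardE enum_children_split // size_takel ?inordK //.
  by rewrite -cardE -ltnS.
rewrite mulr_wick // size_map -cardE -/D -/N scaler_sumr.
rewrite -(pair_bigA _ (fun (i : 'I_N.+1) b => config_weight (split_stack m' m p i b) m' *:
   wick phi (child_word (split_stack m' m p i b) m'))) /=.
apply: eq_bigr => i _; rewrite big_bool /=.
have wE b : config_weight (split_stack m' m p i b) m' =
    config_weight p m * phi (X m * wick phi (take i (child_word p m))).
  rewrite {1}/config_weight (bigD1 m) /=; last by rewrite mm.
  rewrite mulrC; congr (_ * phi (_ * wick _ _)); last first.
    by rewrite /child_word enum_children_split // map_take.
  apply: eq_big => [j|j /andP[mj jm]]; first by rewrite -val_eqE /= mm; lia.
  rewrite -(split_stackK mm i b np rp) /child_word children_merge ?split_stackK //.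
  - exact: split_stack_nested.
  - exact: split_stack_from.
  - by move: mj jm; rewrite -val_eqE /= mm; lia.
rewrite !wE -!scalerDr scalerA; congr (_ *: _).
by rewrite /child_word !enum_stack_split //= map_drop addrC.
Qed.

Lemma sum_read_letter m' m : m = m'.+1 :> nat -> phi (X m) != 0 ->
  \sum_(q | nested q && parents_from m' q)
     config_weight q m' *: wick phi (child_word q m') =
  X m * \sum_(p | nested p && parents_from m p)
     config_weight p m *: wick phi (child_word p m).
Proof.
move=> mm Xm; rewrite mulr_sumr.
rewrite (partition_big (merge_stack m' m) (fun p => nested p && parents_from m p)) /=.
  apply: eq_bigr => p /andP[np rp]; rewrite -scalerAr -(sum_merge_fibre mm) //.
  by apply: eq_bigl => q; rewrite andbA.
by move=> q /andP[nq rq]; rewrite merge_stack_nested ?merge_stack_from.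
Qed.

End Expansion.

Section Moment.
Variables (K : fieldType) (A : algType K) (phi : {scalar A}).
Variables (n : nat) (X : 'I_n.+1 -> A).
Hypothesis X0 : forall k : 'I_n.+1, k != ord0 -> phi (X k) != 0.

(** Iterates [sum_read_letter] from the last letter down to the one after [m]. *)
Lemma prod_wick_expansion (m : 'I_n.+1) :
  \prod_(m.+1 <= k < n.+1) X (inord k) =
  \sum_(p | nested p && parents_from m p)
     config_weight phi X p m *: wick phi (child_word X p m).
Proof.
move: m; suff H d (m : 'I_n.+1) : (m + d = n)%N ->
    \prod_(m.+1 <= k < n.+1) X (inord k) =
    \sum_(p | nested p && parents_from m p)
     config_weight phi X p m *: wick phi (child_word X p m).
  by move=> m; apply: (H (n - m)%N); rewrite subnKC // -ltnS.
elim: d m => [|d IH] m mn.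
  (* Nothing has been read: every position is its own parent. *)
  rewrite addn0 in mn; rewrite mn big_geq // (big_pred1 [ffun k => k]) => [|p /=].
    rewrite /config_weight big_pred0 => [|j]; last first.
      by have := ltn_ord j; move: mn => /=; lia.
    rewrite scale1r /child_word (_ : children _ _ = set0) ?enum_set0 //.
    by apply/setP => k; rewrite !inE ffunE andbN.
  apply/andP/eqP => [[/nestedP[pk _] /forallP rp]|->].
    apply/ffunP => k; rewrite ffunE; apply/val_inj; have := pk k; have := rp k.
    by rewrite -val_eqE /=; have := ltn_ord k; lia.
  split; last by apply/forallP => k; rewrite ffunE eqxx orbT.
  by apply/nestedP; split=> [k|k l kl]; rewrite !ffunE // (ltnW kl) orbT.
have mn' : (m.+1 < n.+1)%N by lia.
have mm : Ordinal mn' = m.+1 :> nat by [].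
rewrite (sum_read_letter mm); last by apply: X0; rewrite -val_eqE.
rewrite -IH /=; last by lia.
by rewrite big_ltn //; congr (X _ * _); apply/val_inj; rewrite /= inordK.
Qed.

(** The first letter is multiplied by the expansion of the others instead of
being expanded itself, which is why its expectation may vanish. *)
Lemma phi_prod_nested : phi (\prod_(k < n.+1) X k) =
  \sum_(p : {ffun 'I_n.+1 -> 'I_n.+1} | nested p)
     \prod_j phi (X j * wick phi (child_word X p j)).
Proof.
have -> : \prod_(k < n.+1) X k = X ord0 * \prod_(1 <= k < n.+1) X (inord k).
  have i0 : inord 0 = ord0 :> 'I_n.+1 by apply/val_inj; rewrite /= inordK.
  rewrite -i0 -(big_ltn (F := fun k => X (inord k))) // big_mkord.
  by apply: eq_bigr => k _; rewrite inord_val.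
rewrite (prod_wick_expansion ord0) mulr_sumr raddf_sum /=; apply: eq_big => [p|p _].
  by rewrite andbC (_ : parents_from _ _) //; apply/forallP.
rewrite -scalerAr scalarZ mulrC (bigD1 ord0) //=; congr (_ * _).
by apply: eq_bigl => j; rewrite lt0n.
Qed.

Definition wick_tcoef (s : seq A) : K :=
  if s is x :: w then phi (x * wick phi w) else 0.

End Moment.

Lemma is_tcoef_wick (K : fieldType) (A : algType K) (phi : {scalar A}) :
  is_tcoef phi (wick_tcoef phi).
Proof. by move=> n X X0; rewrite sum_ncl_nested (phi_prod_nested X0). Qed.

Lemma tcoef_wick (K : fieldType) (A : algType K) (phi : {scalar A}) t x w :
  is_tcoef phi t -> all (fun y => phi y != 0) w ->
  t (x :: w) = phi (x * wick phi w).
Proof.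
by move=> ht w0; rewrite (is_tcoef_uniq ht (@is_tcoef_wick _ _ phi)).
Qed.

(** * Words in coloured letters *)

Section Coloured.
Variables (K : fieldType) (A : algType K) (phi : {scalar A}).
Hypothesis phi1 : phi 1 = 1.
Variables (J : eqType) (S : J -> {pred A}).
Hypothesis subS : forall j, GRing.subalg_closed (S j).
Implicit Types (c : J) (x : A) (w u v : seq (J * A)).

(** A letter carries the index of an algebra containing it, its colour, because
the algebras may overlap. *)
Definition letters w : seq A := unzip2 w.
Definition regular w : bool := all (fun p => (p.2 \in S p.1) && (phi p.2 != 0)) w.
Definition mono c w : bool := all (fun p => p.1 == c) w.
Definition head_avoids c w : bool := if w is p :: _ then p.1 != c else true.

(** Vanishing of the mixed coefficients with at most [N] arguments.  The bound
lets this be proved from freeness together with the factorization of Wick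
elements, by induction on [N]. *)
Definition mixed_vanish (N : nat) : Prop := forall c x w,
  x \in S c -> regular w -> (size w < N)%N -> ~~ mono c w ->
  phi (x * wick phi (letters w)) = 0.

Lemma regular_phi w : regular w -> all (fun x => phi x != 0) (letters w).
Proof. by rewrite /regular all_map; apply: sub_all => p /andP[]. Qed.

(** In the recursion for [wick (x :: U ++ V)], with [x] of the colour of [U], a
pop that reaches [V] has a mixed coefficient.  The remaining pops are those of
the recursion for [wick (x :: U)], and [wick V] factors out on the right. *)
Lemma wick_cat N c u v : mixed_vanish N -> regular u -> regular v -> mono c u ->
  head_avoids c v -> (size (u ++ v) <= N)%N ->
  wick phi (letters (u ++ v)) = wick phi (letters u) * wick phi (letters v).
Proof.
move=> HN; have [m] := ubnP (size u); elim: m u => // m IH [|[d x] u] um.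
  by rewrite /= mul1r.
move=> /= /andP[/andP[/= xd x0] gu] gv /andP[/eqP /= dc uc] cv uvN; subst d.
have IHd k : (0 < k)%N -> (k <= size u)%N ->
    wick phi (letters (drop k (u ++ v))) =
      wick phi (letters (drop k u)) * wick phi (letters v) /\
    wick phi (x :: letters (drop k (u ++ v))) =
      wick phi (x :: letters (drop k u)) * wick phi (letters v).
  move=> k0 ku.
  have -> : drop k (u ++ v) = drop k u ++ v.
    rewrite drop_cat; case: ltngtP ku => // -> _.
    by rewrite subnn drop0 drop_size.
  have gd : regular (drop k u) by apply/allP => p /mem_drop; exact: (allP gu).
  have cd : mono c (drop k u) by apply/allP => p /mem_drop; exact: (allP uc).
  move: uvN um; rewrite /= size_cat => uvN um; split.
    by apply: IH; rewrite // ?size_cat size_drop; lia.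
  apply: (IH ((c, x) :: drop k u)); rewrite /= ?size_cat ?size_drop ?eqxx ?xd ?x0 //; lia.
have IHu : wick phi (letters (u ++ v)) = wick phi (letters u) * wick phi (letters v).
  by apply: IH => //; rewrite ltnW.
have sumE : \sum_(k < size (letters (u ++ v))) phi (x * wick phi (take k.+1 (letters (u ++ v)))) *:
      (wick phi (drop k.+1 (letters (u ++ v))) + wick phi (x :: drop k.+1 (letters (u ++ v)))) =
    (\sum_(k < size (letters u)) phi (x * wick phi (take k.+1 (letters u))) *:
      (wick phi (drop k.+1 (letters u)) + wick phi (x :: drop k.+1 (letters u)))) *
    wick phi (letters v).
  rewrite !size_map size_cat big_split_ord /= [X in _ + X]big1 ?addr0 => [|k _]; last first.
    rewrite /letters -map_take -map_drop; set w := take _ _.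
    have wE : w = u ++ take k.+1 v.
      by rewrite /w take_cat -addnS ltnNge leq_addr /= addKn.
    rewrite (HN c x w) ?scale0r //.
    - apply/allP => p pw; have := mem_take pw; rewrite mem_cat => /orP[].
        exact: (allP gu).
      exact: (allP gv).
    - by rewrite (leq_ltn_trans _ uvN) // wE !size_cat leq_add2l size_take_min geq_minr.
    - rewrite wE /mono all_cat negb_and; move: (nat_of_ord k) (ltn_ord k) cv => j.
      case: (v) => //= p v' _ /negPf ->.
      by rewrite orbT.
  rewrite mulr_suml; apply: eq_bigr => k _.
  have kS : (k.+1 <= size u)%N by apply: ltn_ord.
  have [E1 E2] := IHd k.+1 isT kS.
  rewrite /letters -!map_drop -!map_take -/(letters _) E1 E2 -mulrDl scalerAl.
  by rewrite takel_cat.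
by rewrite !wick_cons sumE IHu mulrA -mulrBl scalerAl -mulrBl.
Qed.

Lemma wick_subalg c u : regular u -> mono c u -> wick phi (letters u) \in S c.
Proof.
have [S1 SL SM] := subS c.
have S0 : 0 \in S c by have := SL (-1) 1 1 S1 S1; rewrite scaleN1r addNr.
have SZ a y : y \in S c -> a *: y \in S c.
  by move=> yS; have := SL a y 0 yS S0; rewrite addr0.
have SD y z : y \in S c -> z \in S c -> y + z \in S c.
  by move=> yS zS; have := SL 1 y z yS zS; rewrite scale1r.
have SN y : y \in S c -> - y \in S c by move=> yS; rewrite -scaleN1r SZ.
have [m] := ubnP (size u); elim: m u => // m IH [|[d x] u] //= um.
move=> /andP[/andP[/= xd x0] gu] /andP[/eqP /= dc uc].
rewrite {d}dc in xd um *.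
have gd k : regular (drop k u) by apply/allP => p /mem_drop; exact: (allP gu).
have cd k : mono c (drop k u) by apply/allP => p /mem_drop; exact: (allP uc).
rewrite wick_cons; apply/SD; last by apply/SN/IH.
apply/SZ; apply/SD; first by apply: SM => //; apply: IH.
apply/SN; apply: (big_ind (fun y => y \in S c)) => // k _; apply/SZ.
have ku : (k < size u)%N by rewrite -(size_map snd).
rewrite /letters -!map_drop; apply/SD.
  by apply: IH => //; rewrite size_drop; lia.
apply: (IH ((c, x) :: drop k.+1 u)).
- by rewrite /= size_drop; lia.
- by rewrite /regular /= xd x0; exact: gd.
- by rewrite /mono /= eqxx; exact: cd.
Qed.

Lemma run_split c w : exists u v, [/\ w = u ++ v, mono c u & head_avoids c v].
Proof.
elim: w => [|p w [u [v [-> cu cv]]]]; first by exists [::], [::].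
have [pc|pc] := eqVneq p.1 c; last by exists [::], (p :: u ++ v).
by exists (p :: u), v; rewrite /= pc eqxx.
Qed.

Definition centred w : bool := all (fun p => (p.2 \in S p.1) && (phi p.2 == 0)) w.
Definition alternating w : bool := sorted (fun c d => c != d) (unzip1 w).

Section Free.
Hypothesis freeS : forall w, w != [::] -> centred w -> alternating w ->
  phi (\prod_(x <- letters w) x) = 0.

(** The first run of [v] contributes, by [wick_cat], a centred element of its
algebra, which is moved to the alternating product [s]; when [v] is exhausted,
freeness applies.  The word [take 1 v] in the hypothesis only says that the last
colour of [s] differs from the first colour of [v]. *)
Lemma phi_prod_wick N s v : mixed_vanish N -> centred s -> regular v ->
  alternating (s ++ take 1 v) -> (size v <= N)%N -> s ++ v != [::] ->
  phi (\prod_(x <- letters s) x * wick phi (letters v)) = 0.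
Proof.
move=> HN; have [m] := ubnP (size v); elim: m s v => // m IH s [|[c x] w] vm cs gv sv vN s0.
  by rewrite mulr1; rewrite !cats0 in s0 sv; apply: freeS.
have [u [v' [wE cu cv]]] := run_split c w; rewrite {w}wE in vm gv sv vN s0 *.
have {gv} [gu gv] : regular ((c, x) :: u) /\ regular v'.
  by apply/andP; rewrite -all_cat.
have cu' : mono c ((c, x) :: u) by rewrite /= eqxx.
rewrite -cat_cons (wick_cat HN gu gv cu') // mulrA.
set b := wick phi _.
have -> : \prod_(x <- letters s) x * b = \prod_(x <- letters (rcons s (c, b))) x.
  by rewrite /letters /unzip2 map_rcons -cats1 big_cat big_seq1.
apply: IH => //.
- by move: vm => /=; rewrite size_cat; lia.
- rewrite /centred all_rcons -/(centred s) cs andbT /= wick_subalg //=; apply/eqP/phi_wick => //.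
  exact: (regular_phi gu).
- move: sv; rewrite /= take0 cat_rcons /alternating /unzip1 !map_cat /=.
  have cp : path (fun c d => c != d) c [seq i.1 | i <- take 1 v'].
    by case: (v') cv => //= p v2; rewrite take0 /= andbT eq_sym.
  by case: (s) => //= q s'; rewrite !cat_path /= andbT => /andP[-> ->].
- by move: vN; rewrite /= size_cat; lia.
- by case: (s).
Qed.

(** Absorb into [x] the initial run of [w] of the colour of [x]: this gives an
element [y] of the same algebra, followed by a nonempty word of another first
colour.  Both [y - phi y] and the scalar [phi y] contribute zero. *)
Lemma free_mixed_vanish N : mixed_vanish N.
Proof.
elim: N => // N HN c x w xc gw wN cw.
have [u [v [wE cu cv]]] := run_split c w; rewrite {w}wE in gw wN cw *.
have {gw} [gu gv] : regular u /\ regular v by apply/andP; rewrite -all_cat.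
have v0 : v != [::] by apply: contraNneq cw => ->; rewrite cats0.
have [S1 SL SM] := subS c.
rewrite (wick_cat HN gu gv cu) // mulrA; set y := x * _.
have yc : y \in S c by apply: SM => //; apply: wick_subalg.
rewrite -[y](addrNK (phi y *: 1)) mulrDl raddfD /= -scalerAl mul1r scalarZ.
rewrite (phi_wick phi1 (regular_phi gv)) ?mulr0 ?addr0; last by case: (v) v0.
have := @phi_prod_wick N [:: (c, y - phi y *: 1)] v HN; rewrite /= big_seq1; apply=> //.
  rewrite /centred /= raddfB /= scalarZ phi1 mulr1 subrr eqxx !andbT.
  by rewrite addrC -scaleNr SL.
by case: (v) cv => //= p v2; rewrite take0 /alternating /= andbT eq_sym.
by move: wN; rewrite size_cat; lia.
Qed.
End Free.

(** For a centred [x], adding 1 gives a letter of expectation 1, whose Wick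
element is [x + 1 - 1 = x]. *)
Lemma wick_centred_shift w :
  (forall N, mixed_vanish N) -> centred w -> alternating w ->
  wick phi (letters [seq (p.1, p.2 + 1) | p <- w]) = \prod_(x <- letters w) x.
Proof.
move=> HN; elim: w => [|[c x] w IH]; first by rewrite big_nil.
move=> cxw aw; have /andP[/andP[/= xc /eqP x0] cw] := cxw.
rewrite big_cons -[RHS]/(x * _) -IH //; last exact: path_sorted aw.
set v := map _ w.
have gv y d : y \in S d -> phi y = 0 -> regular [:: (d, y + 1)].
  move=> yd y0; have [S1 SL _] := subS d.
  rewrite /regular /= raddfD /= y0 phi1 add0r oner_eq0 !andbT.
  by have := SL 1 y 1 yd S1; rewrite scale1r.
rewrite (@wick_cat _ c [:: (c, x + 1)] v (HN (size v).+1)) ?size_cat //=.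
- by congr (_ * _); rewrite [LHS]wick1 /= (raddfD phi) /= x0 phi1 add0r invr1 scale1r addrK.
- exact: gv.
- rewrite /regular all_map; apply/allP => p /(allP cw)/andP[pS /eqP p0].
  by have := gv _ _ pS p0; rewrite /regular /= andbT.
- by rewrite eqxx.
- by rewrite /v; case: (w) aw => //= p w' /andP[+ _]; rewrite eq_sym.
Qed.

End Coloured.

(** * Freeness and vanishing of mixed coefficients *)

Lemma free_family_word (K : fieldType) (A : algType K) (phi : {scalar A})
    (J : eqType) (S : J -> {pred A}) : free_family phi S ->
  forall w, w != [::] -> centred phi S w -> alternating w ->
  phi (\prod_(x <- letters w) x) = 0.
Proof.
move=> free [//|p v] _ /allP cv /(sortedP p.1) av.
have mem (k : 'I_(size v).+1) : nth p (p :: v) k \in p :: v.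
  by apply: mem_nth; apply: ltn_ord.
rewrite big_map (big_nth p) big_mkord.
apply: (free _ (fun k : 'I_(size v).+1 => (nth p (p :: v) k).1)
  (fun k : 'I_(size v).+1 => (nth p (p :: v) k).2)) => [k|j k jk|k].
- by have /andP[] := cv _ (mem k).
- have := av j; rewrite size_map -jk => /(_ (ltn_ord k)).
  rewrite !(nth_map p) -?jk ?ltn_ord // => [/eqP//|].
  exact: ltnW (ltn_ord k).
- by have /andP[_ /eqP] := cv _ (mem k).
Qed.

Theorem proposition2p2 (R : realType) (A : algType R[i]) (phi : {scalar A})
    (phi1 : phi 1 = 1) (t : seq A -> R[i]) (ht : is_tcoef phi t)
    (I : Type) (S : I -> {pred A})
    (hS : forall j : I, GRing.subalg_closed (S j)) :
  free_family phi S
  <->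
  (forall (n : nat) (i : 'I_n.+1 -> I) (a : 'I_n.+1 -> A),
     (forall k, a k \in S (i k)) ->
     (forall k : 'I_n.+1, k != ord0 -> phi (a k) != 0) ->
     (exists l k : 'I_n.+1, i l <> i k) ->
     t [seq a k | k <- enum 'I_n.+1] = 0).
Proof.
(* Splitting words into runs needs a decidable equality on colours. *)
pose J : eqType := {classic I}; pose T : J -> {pred A} := S.
have hT : forall j, GRing.subalg_closed (T j) := hS.
split=> [free n i a aS a0 [l1 [l2 ll]]|tmix n e a aS alt a0].
- pose w := [seq (i (lift ord0 j) : J, a (lift ord0 j)) | j <- enum 'I_n].
  have gw : regular phi T w.
    apply/allP => _ /mapP[j _ ->] /=; rewrite [_ \in _]aS a0 //.
  have wE : letters w = [seq a (lift ord0 j) | j <- enum 'I_n].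
    by rewrite /letters /unzip2 -map_comp.
  rewrite enum_ordSl /= -map_comp -[map _ _]wE (tcoef_wick _ ht); last exact: regular_phi gw.
  have F := @free_family_word _ _ phi J T free.
  have HN : mixed_vanish phi T (size w).+1 by apply: free_mixed_vanish.
  apply: (HN (i ord0) (a ord0) w) => //.
  apply/negP => cw; have iE j : i j = i ord0.
    case: (unliftP ord0 j) => [j' ->|-> //].
    have /(allP cw)/eqP : (i (lift ord0 j') : J, a (lift ord0 j')) \in w.
      by apply: map_f; rewrite mem_enum.
    by [].
  by apply: ll; rewrite !iE.
have HN N : mixed_vanish phi T N.
  move=> c x w xc gw _ cw; rewrite -(tcoef_wick _ ht) ?(regular_phi gw) //.
  pose p0 := (c, x); pose q (k : 'I_(size w).+1) := nth p0 (p0 :: w) k.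
  have -> : x :: letters w = [seq (q k).2 | k <- enum 'I_(size w).+1].
    by rewrite (map_comp snd q) map_nth_enum.
  have qg (k : 'I_(size w).+1) : k != ord0 -> ((q k).2 \in T (q k).1) && (phi (q k).2 != 0).
    case: k => -[|k] //= kw _; rewrite /q /=.
    exact: (allP gw _ (mem_nth p0 kw)).
  apply: (tmix _ (fun k => (q k).1)).
  - move=> k; have [->//|/qg/andP[]//] := eqVneq k ord0.
  - by move=> k /qg/andP[].
  - have /allPn[p /(nthP p0)[j jw pE] pc] := cw.
    exists (lift ord0 (Ordinal jw)), ord0.
    by move=> E; case/negP: pc; apply/eqP; rewrite -pE; exact: E.
pose w := [seq (e k : J, a k) | k <- enum 'I_n.+1].
have cw : centred phi T w.
  by apply/allP => _ /mapP[k _ ->] /=; rewrite a0 eqxx andbT; apply: aS.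
have aw : alternating w.
  rewrite /alternating; have -> : unzip1 w = [seq e k : J | k <- enum 'I_n.+1].
    by rewrite /unzip1 -map_comp.
  apply/(sortedP (e ord0 : J)) => j; rewrite size_map size_enum_ord => jn.
  rewrite !(nth_map ord0) -?enumT ?size_enum_ord ?(ltnW jn) //.
  by apply/eqP/alt; rewrite !nth_enum_ord // ltnW.
have -> : \prod_(k < n.+1) a k = \prod_(x <- letters w) x.
  by rewrite /letters /unzip2 -map_comp big_map enumT unlock.
rewrite -(wick_centred_shift phi1 hT HN) //; apply: phi_wick => //.
  rewrite all_map all_map; apply/allP => p /(allP cw)/andP[_ /eqP pp].
  by rewrite /= raddfD /= pp phi1 add0r oner_eq0.
by rewrite /w enum_ordSl.
Qed.
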